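(* Let $\pi\in\mathbb{R}^n\setminus\{0\}$, $\pi_0<\pi_1$ real, and $F=\{(x,t)\in\mathbb{R}^{n+1}:\pi_0\le\pi^Tx\le\pi_1\}$. Let $A\in\mathbb{R}^{n\times n}$ be invertible, $c\in\mathbb{R}^n$, and $$Q=\{(x,t)\in\mathbb{R}^{n+1}:\|A(x-c)\|_2^2\le t\}.$$ Let $a=\frac{\pi_0+\pi_1-2\pi^Tc}{\|A^{-T}\pi\|_2^2}$, $b=-\frac{(\pi_1-\pi^Tc)(\pi_0-\pi^Tc)}{\|A^{-T}\pi\|_2^2}$, and $\widehat A=P^\perp_{A^{-T}\pi}A$. Then $$\mathrm{conv}\bigl(Q\setminus \mathrm{int}(F)\bigr)=Q\cap C,\qquad C=\bigl\{(x,t)\in\mathbb{R}^{n+1}:\|\widehat A(x-c)\|_2^2+a\,\pi^T(x-c)+b\le t\bigr\}.$$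
   Context: For $v\in\mathbb{R}^n\setminus\{0\}$, $P_v^\perp=I-\frac{vv^T}{\|v\|_2^2}$. $A^{-T}=(A^{-1})^T$. $\mathrm{int}$ is the topological interior and $\mathrm{conv}$ the convex hull. *)

(* Defs.v *)
From mathcomp Require Import all_boot all_order all_algebra.
From mathcomp Require Import all_classical all_reals all_analysis.

Set Implicit Arguments.
Unset Strict Implicit.
Unset Printing Implicit Defensive.

Import Order.TTheory GRing.Theory Num.Theory.
Import numFieldNormedType.Exports.

Local Open Scope classical_set_scope.
Local Open Scope ring_scope.

(* The library norm `|v| on 'cV[R]_n is the sup norm, hence this definition. *)
Definition norm2 (R : realType) (n : nat) (v : 'cV[R]_n) : R :=
  Num.sqrt (\sum_(i < n) v i 0 ^+ 2).

Definition dotv (R : realType) (n : nat) (u v : 'cV[R]_n) : R :=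
  (u^T *m v) 0 0.

(* Meaningful for v != 0 only; the totalized inverse gives 1%:M at v = 0. *)
Definition orthproj (R : realType) (n : nat) (v : 'cV[R]_n) : 'M[R]_n :=
  1%:M - (norm2 v ^+ 2)^-1 *: (v *m v^T).

Definition convex_hull (R : realType) (E : lmodType R) (S : set E) : set E :=
  smallest (@convex_set R E) S.

(* R^{n+1} split as (x, t). The factor R^o carries the R-module structure of R;
   the topology is the product topology. *)
Definition Rn1 (R : realType) (n : nat) : normedModType R :=
  ('cV[R]_n * R^o)%type.

(* Main.v *)
Require Import Defs.
From mathcomp Require Import all_boot all_order all_algebra.
From mathcomp Require Import all_classical all_reals all_analysis.
From mathcomp Require Import ring lra.
Import Order.TTheory GRing.Theory Num.Theory.
Import numFieldNormedType.Exports.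
Local Open Scope classical_set_scope.
Local Open Scope ring_scope.

(* Write y = A (x - c) and w = A^-T pi, so that pi^T x = w^T y + pi^T c.
   Splitting y along w and its orthogonal complement, the left-hand side of the
   inequality defining C equals
     |y|^2 - (pi^T x - pi_0) (pi^T x - pi_1) / |w|^2,
   i.e. C replaces the quadratic along w by its chord over [pi_0, pi_1]. Hence
   C contains the part of Q outside the open slab, and a point of C inside the
   slab lies on a segment, in direction A^-1 w in the x-space, joining two points
   of Q on the two bounding hyperplanes. *)

Section Dot.
Set Implicit Arguments.
Unset Strict Implicit.
Variables (R : realType) (n : nat).
Implicit Types (u v w : 'cV[R]_n) (M : 'M[R]_n).

Lemma dotvE u v : dotv u v = \sum_(i < n) u i 0 * v i 0.
Proof. by rewrite /dotv mxE; apply: eq_bigr => i _; rewrite mxE. Qed.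

Lemma dotvC u v : dotv u v = dotv v u.
Proof. by rewrite !dotvE; apply: eq_bigr => i _; rewrite mulrC. Qed.

Lemma dotvDr u v w : dotv u (v + w) = dotv u v + dotv u w.
Proof. by rewrite /dotv mulmxDr mxE. Qed.

Lemma dotvZr u k v : dotv u (k *: v) = k * dotv u v.
Proof. by rewrite /dotv -scalemxAr mxE. Qed.

Lemma dotvBr u v w : dotv u (v - w) = dotv u v - dotv u w.
Proof. by rewrite dotvDr -scaleN1r dotvZr mulN1r. Qed.

Lemma dotvDl u v w : dotv (u + v) w = dotv u w + dotv v w.
Proof. by rewrite dotvC dotvDr !(dotvC w). Qed.

Lemma dotvZl k u v : dotv (k *: u) v = k * dotv u v.
Proof. by rewrite dotvC dotvZr dotvC. Qed.

Lemma dotv_mulmxr u M v : dotv u (M *m v) = dotv (M^T *m u) v.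
Proof. by rewrite /dotv trmx_mul trmxK mulmxA. Qed.

Lemma norm2_sqr v : norm2 v ^+ 2 = dotv v v.
Proof.
rewrite sqr_sqrtr; first by rewrite dotvE; apply: eq_bigr => i _; rewrite expr2.
by apply: sumr_ge0 => i _; exact: sqr_ge0.
Qed.

Lemma dotv_ge0 v : 0 <= dotv v v.
Proof. by rewrite -norm2_sqr sqr_ge0. Qed.

Lemma dotv_gt0 v : v != 0 -> 0 < dotv v v.
Proof.
move=> v0; rewrite lt0r dotv_ge0 andbT; apply: contraNneq v0 => vv0.
apply/eqP/colP => i; rewrite mxE; apply/eqP; rewrite -sqrf_eq0 expr2.
move: vv0; rewrite dotvE => /psumr_eq0P -> // j _.
by rewrite -expr2 sqr_ge0.
Qed.

Lemma orthproj_mulmx w v :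
  orthproj w *m v = v - (dotv w v / norm2 w ^+ 2) *: w.
Proof.
rewrite /orthproj mulmxBl mul1mx -scalemxAl -mulmxA.
by rewrite [w^T *m v]mx11_scalar mul_mx_scalar scalerA [in RHS]mulrC.
Qed.

(** Pythagoras: the projection removes the component of [v] along [w], whose squared norm is the
    subtracted quotient. *)
Lemma norm2_orthproj w v : w != 0 ->
  norm2 (orthproj w *m v) ^+ 2 = norm2 v ^+ 2 - dotv w v ^+ 2 / norm2 w ^+ 2.
Proof.
move=> /dotv_gt0/lt0r_neq0 w0; rewrite orthproj_mulmx !norm2_sqr -scaleNr.
rewrite !dotvDl !dotvDr !dotvZl !dotvZr (dotvC v w).
by field.
Qed.

Lemma dotv_continuous u : continuous (dotv u : 'cV[R]_n -> R).
Proof.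
have -> : dotv u = fun v => \sum_(i < n) u i 0 * v i 0.
  by apply/funext => v; rewrite dotvE.
apply: continuous_big => [|i _ v]; first exact: add_continuous.
exact: (cvgMl_tmp (@coord_continuous R n 1 i 0 v)).
Qed.

(** Around an interior point the slab contains small steps along both [p] and [-p]; these shift
    [dotv p] by a nonzero amount either way, so neither bound is attained. Conversely, strict bounds
    persist nearby by continuity. *)
Lemma interior_slab (p : 'cV[R]_n) (p0 p1 : R) : p != 0 ->
  interior [set z : Rn1 R n | p0 <= dotv p z.1 <= p1] =
  [set z : Rn1 R n | p0 < dotv p z.1 < p1].
Proof.
move=> p_neq0; have pp_gt0 := dotv_gt0 p_neq0.
apply/seteqP; split => z /=.
  have line_cvg : (fun h : R => (z.1 + h *: p, z.2) : Rn1 R n) h @[h --> 0] --> z.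
    have xcvg : (z.1 + h *: p) @[h --> (0 : R)] --> z.1.
      rewrite -[X in _ --> X]addr0 -(scale0r p).
      by apply: cvgD; [exact: cvg_cst|apply: cvgZr_tmp; exact: cvg_id].
    rewrite [X in _ --> X]surjective_pairing.
    exact: cvg_pair xcvg (cvg_cst _).
  move=> /line_cvg /nbhs_ballP[e /= e_gt0 slab].
  have e2_ball : ball (0 : R) e (e / 2).
    by rewrite -ball_normE /= sub0r normrN gtr0_norm ?divr_gt0//; lra.
  have e2N_ball : ball (0 : R) e (- (e / 2)).
    by rewrite -ball_normE /= sub0r opprK gtr0_norm ?divr_gt0//; lra.
  move: (slab _ e2_ball) (slab _ e2N_ball) => /=.
  rewrite !dotvDr !dotvZr => /andP[_ lt_p1] /andP[lt_p0 _].
  have : 0 < e / 2 * dotv p p by rewrite mulr_gt0 ?divr_gt0.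
  by apply/implyP; apply/implyP => ?; apply/andP; split; lra.
move=> /andP[lt_p0 lt_p1].
have dotv_cvg : dotv p z'.1 @[z' --> z] --> dotv p z.1.
  by apply: cvg_comp; [exact: cvg_fst|exact: dotv_continuous].
near=> z' => /=; apply/andP; split; apply: ltW; near: z'.
- exact: (cvgr_gt _ dotv_cvg).
- exact: (cvgr_lt _ dotv_cvg).
Unshelve. all: by end_near. Qed.

(** Serves for both [Q] (with [a = b = 0]) and [C]. With [u], [v] the images under [M] of the two
    centred points, the convexity gap of the quadratic is [k * (1 - k)] times the squared norm of
    [u - v], and the affine terms contribute none. *)
Lemma convex_quadratic_epigraph M (p c : 'cV[R]_n) (a b : R) :
  convex_set [set z : Rn1 R n |
    norm2 (M *m (z.1 - c)) ^+ 2 + a * dotv p (z.1 - c) + b <= (z.2 : R)].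
Proof.
apply/convex_setW => -[x t] [y s]; rewrite !inE /= => xt ys l l0 l1.
have -> : conv l ((x, t) : convex_lmodType (Rn1 R n)) (y, s) =
    (l%:num *: x + (1 - l%:num) *: y, l%:num * t + (1 - l%:num) * s) by [].
rewrite inE /=; set k := l%:num in l0 l1 *.
have -> : k *: x + (1 - k) *: y - c = k *: (x - c) + (1 - k) *: (y - c).
  by rewrite 2!scalerBr addrACA -opprD -scalerDl subrKC scale1r.
move: xt ys; rewrite !norm2_sqr (mulmxDr _ (k *: _)) -!scalemxAr.
set u := M *m (x - c); set v := M *m (y - c).
rewrite !dotvDl !dotvDr !dotvZl !dotvZr (dotvC v u) => xt ys.
have := dotv_ge0 (u - v); rewrite -scaleN1r.
rewrite !dotvDl !dotvDr !dotvZl !dotvZr (dotvC v u) => uv_ge0.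
have {}uv_ge0 : 0 <= k * (1 - k) * (dotv u u + - 1 * dotv u v
    + (- 1 * dotv u v + - 1 * (- 1 * dotv v v))).
  by rewrite mulr_ge0// mulr_ge0// ?subr_ge0 ltW.
have {}xt := ler_wpM2l (ltW l0) xt.
have k1_ge0 : 0 <= 1 - k by rewrite subr_ge0 ltW.
have {}ys := ler_wpM2l k1_ge0 ys.
nra.
Qed.
End Dot.

Theorem corollary4p1 (R : realType) (n : nat) (p : 'cV[R]_n) (p0 p1 : R)
    (A : 'M[R]_n) (c : 'cV[R]_n)
    (p_neq0 : p != 0) (p01 : p0 < p1) (A_inv : A \in unitmx) :
  let F : set (Rn1 R n) := [set z : Rn1 R n | p0 <= dotv p z.1 <= p1] in
  let Q : set (Rn1 R n) := [set z : Rn1 R n | norm2 (A *m (z.1 - c)) ^+ 2 <= (z.2 : R)] in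
  let w : 'cV[R]_n := (invmx A)^T *m p in
  let a : R := (p0 + p1 - 2 * dotv p c) / norm2 w ^+ 2 in
  let b : R := - ((p1 - dotv p c) * (p0 - dotv p c) / norm2 w ^+ 2) in
  let Ahat : 'M[R]_n := orthproj w *m A in
  let C : set (Rn1 R n) :=
    [set z : Rn1 R n | norm2 (Ahat *m (z.1 - c)) ^+ 2 + a * dotv p (z.1 - c) + b
             <= (z.2 : R)] in
  convex_hull (Q `\` interior F) = Q `&` C.
Proof.
move=> F Q w a b Ahat C.
have w_neq0 : w != 0.
  apply: contraNneq p_neq0 => w0.
  by rewrite -[p]mul1mx -trmx1 -(mulVmx A_inv) trmx_mul -mulmxA -/w w0 mulmx0.
have dotw v : dotv w (A *m v) = dotv p v.
  by rewrite dotv_mulmxr /w mulmxA -trmx_mul mulVmx// trmx1 mul1mx.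
set W := norm2 w ^+ 2.
have W_gt0 : 0 < W by rewrite /W norm2_sqr dotv_gt0.
have W_neq0 := lt0r_neq0 W_gt0.
have Q_convex : convex_set Q.
  have -> : Q = [set z : Rn1 R n |
      norm2 (A *m (z.1 - c)) ^+ 2 + 0 * dotv p (z.1 - c) + 0 <= (z.2 : R)].
    by apply/funext => z; rewrite /Q /= mul0r !addr0.
  exact: convex_quadratic_epigraph.
have C_convex : convex_set C by exact: convex_quadratic_epigraph.
(* The projection subtracts [dotv p (x - c) ^+ 2 / W]; [a] and [b] complete this to a quadratic in
   [dotv p x] with roots [p0] and [p1]. *)
have gapE (x : 'cV[R]_n) :
    norm2 (Ahat *m (x - c)) ^+ 2 + a * dotv p (x - c) + b =
    norm2 (A *m (x - c)) ^+ 2 - (dotv p x - p0) * (dotv p x - p1) / W.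
  rewrite /Ahat -mulmxA norm2_orthproj// dotw dotvBr /a /b -/W.
  by field.
rewrite interior_slab//; apply/seteqP; split.
  apply: smallest_sub => [x y l|z [Qz /negP]].
    rewrite !inE => -[Qx Cx] [Qy Cy]; split; apply/set_mem.
      by apply: Q_convex; rewrite inE.
    by apply: C_convex; rewrite inE.
  rewrite negb_and -!leNgt => out_slab; split=> //.
  (* Outside the open slab both factors of the product have the same weak sign, so [C] asks no more
     than [Q]. *)
  rewrite /C /= gapE; apply: le_trans Qz; rewrite gerBl divr_ge0 ?(ltW W_gt0)//.
  by case/orP: out_slab => ?; [rewrite mulr_le0|rewrite mulr_ge0]; rewrite ?subr_le0 ?subr_ge0//; lra.
move=> z [Qz Cz] Y [Y_convex QFY].
have [/andP[lt_p0 lt_p1]|out_slab] := boolP (p0 < dotv p z.1 < p1); last first.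
  by apply: QFY; split=> //; exact/negP.
(* The two endpoints are lifted to the graph of the quadratic, and then by the
   slack of z in C, so that the chord passes exactly through z. *)
set r := dotv p z.1 in lt_p0 lt_p1.
(* Moving along [d] changes [A (x - c)] only along [w]. Since [dotv p d = W], the coefficient
   [(q - r) / W] leads from level [r] to level [q] of [dotv p]. *)
pose d := invmx A *m w.
have Ad : A *m d = w by rewrite /d mulmxA mulmxV// mul1mx.
have pd : dotv p d = W by rewrite -dotw Ad /W norm2_sqr.
pose slack := (z.2 : R) - (norm2 (A *m (z.1 - c)) ^+ 2 - (r - p0) * (r - p1) / W).
have slack_ge0 : 0 <= slack by rewrite subr_ge0 -gapE.
pose pt q : Rn1 R n := (z.1 + ((q - r) / W) *: d,
  norm2 (A *m (z.1 + ((q - r) / W) *: d - c)) ^+ 2 + slack).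
have ptE q : dotv p (pt q).1 = q by rewrite /= dotvDr dotvZr pd divfK// subrKC.
have Ypt q : q \in [:: p0; p1] -> pt q \in (Y : set (convex_lmodType (Rn1 R n))).
  move=> q01; rewrite inE; apply: QFY; split; first by rewrite /Q /= lerDl.
  (* A point on a bounding hyperplane violates one of the strict inequalities of the open slab. *)
  rewrite /= ptE => /andP[]; move: q01; rewrite !inE => /orP[] /eqP ->.
    by rewrite ltxx.
  by rewrite ltxx.
(* Barycentric weight of [r] in the interval from [p0] to [p1]; [conv] attaches it to its first
   point, [pt p0]. *)
have l_ge0 : 0 <= (p1 - r) / (p1 - p0) by rewrite divr_ge0// subr_ge0 ltW.
have l_le1 : (p1 - r) / (p1 - p0) <= 1.
  by rewrite ler_pdivrMr ?subr_gt0// mul1r; lra.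
pose l : {i01 R} := Itv01 l_ge0 l_le1.
have := Y_convex (pt p0) (pt p1) l.
rewrite !Ypt ?inE ?eqxx ?orbT// => /(_ isT isT).
suff -> : conv l (pt p0 : convex_lmodType (Rn1 R n)) (pt p1) = z by [].
have p10 : p1 - p0 != 0 by rewrite subr_eq0 gt_eqF.
have -> : conv l (pt p0 : convex_lmodType (Rn1 R n)) (pt p1) =
    ((p1 - r) / (p1 - p0)) *: pt p0 + (1 - (p1 - r) / (p1 - p0)) *: pt p1 by [].
rewrite [RHS]surjective_pairing; congr pair => /=.
  rewrite !scalerDr !scalerA addrACA -!scalerDl.
  rewrite (_ : _ * _ + _ * _ = 0); last by field; rewrite p10 W_neq0.
  by rewrite subrKC scale1r scale0r addr0.
have normE q : norm2 (A *m (z.1 + ((q - r) / W) *: d - c)) ^+ 2 =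
   norm2 (A *m (z.1 - c)) ^+ 2 + 2 * ((q - r) / W) * (r - dotv p c)
     + (q - r) ^+ 2 / W.
  rewrite addrAC mulmxDr -scalemxAr Ad !norm2_sqr !dotvDl !dotvDr.
  rewrite !dotvZl !dotvZr (dotvC _ w) !dotw dotvBr -/r -(norm2_sqr w) -/W.
  by field.
(* The weights average [q - r] to [0] and [(q - r) ^+ 2] to [(r - p0) * (p1 - r)]; the latter, over
   [W], cancels against the product term in [slack], leaving [z.2]. *)
rewrite !normE /slack /GRing.scale /=.
by field; rewrite p10 W_neq0.
Qed.
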